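(* For $m\ge1$ and $1\le i,j\le 2m$ let $P(m,i,j)$ be the probability that a uniformly random $\sigma\in\mathcal{B}_{2m}$ satisfies $\sigma(i)=j$. Then, as $m\to\infty$, \[ P(m,1,1)\to\tfrac14,\qquad P(m,1,2m-1)\to\tfrac14,\qquad P(m,2,2m-1)\to\tfrac14, \] and $P(m,1,2)=P(m,1,2m)=P(m,2,2)=0$.
   Context: A permutation $\sigma\in S_n$ is alternating if $\sigma(1)<\sigma(2)>\sigma(3)<\cdots$; it is Baxter if there are no indices $1\le i<j<k\le n$ with $\sigma(j+1)<\sigma(i)<\sigma(k)<\sigma(j)$ or $\sigma(j)<\sigma(k)<\sigma(i)<\sigma(j+1)$. $\mathcal{B}_n$ is the set of Baxter permutations $\sigma\in S_n$ such that both $\sigma$ and $\sigma^{-1}$ are alternating.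
   Formalization: P(m,2,2)=0 is stated for m≥2 only: at m=1 the set B_2 consists of the identity alone, so P(1,2,2)=1 and the claim fails there; all other claims are as stated. *)

(* Defs.v *)
From HB Require Import structures.
From mathcomp Require Import all_boot all_order all_fingroup all_algebra.
From mathcomp Require Import all_classical all_reals all_analysis.

Set Implicit Arguments.
Unset Strict Implicit.
Unset Printing Implicit Defensive.

Import Order.TTheory GRing.Theory Num.Theory.
Import numFieldNormedType.Exports.

(* A permutation of {1, ..., n} is an element of 'S_n, the element k of
   {1, ..., n} being represented by the ordinal of value k - 1. *)

(* s(1) < s(2) > s(3) < ...: the 1-based odd positions, where s ascends, are
   those whose ordinal has an even value. *)
Definition alternating (n : nat) (s : 'S_n) : bool :=
  [forall k : 'I_n, forall k1 : 'I_n,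
    (k1 == k.+1 :> nat) ==> (if odd k then s k1 < s k else s k < s k1)%N].

(* The ordinal j1 plays the role of j + 1. *)
Definition Baxter (n : nat) (s : 'S_n) : bool :=
  ~~ [exists i : 'I_n, exists j : 'I_n, exists k : 'I_n, exists j1 : 'I_n,
       [&& (i < j)%N, (j < k)%N, j1 == j.+1 :> nat &
           [&& s j1 < s i, s i < s k & s k < s j]%N
        || [&& s j < s k, s k < s i & s i < s j1]%N]].

Definition doubly_alternating_Baxter (n : nat) : {set 'S_n} :=
  [set s : 'S_n | [&& Baxter s, alternating s & alternating (s^-1)%g]].

(* s(i) = j, for i and j counted from 1; false if i or j is not in
   {1, ..., n}. *)
Definition sends (n : nat) (s : 'S_n) (i j : nat) : bool :=
  [exists k : 'I_n, (k.+1 == i) && ((s k).+1 == j)].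

(* The only element of doubly_alternating_Baxter 2 is the identity, so that
   P R 1 2 2 = 1. *)
Definition P (R : realType) (m i j : nat) : R :=
  (#|[set s in doubly_alternating_Baxter (2 * m) | sends s i j]|%:R
   / #|doubly_alternating_Baxter (2 * m)|%:R)%R.

(* Main.v *)
Require Import Defs.
From HB Require Import structures.
From mathcomp Require Import all_boot all_order all_fingroup all_algebra.
From mathcomp Require Import all_classical all_reals all_analysis.
From mathcomp Require Import zify ring lra.

(* For even n, a doubly alternating Baxter permutation s of size n > 0 splits
   uniquely as a skew sum of 1 (+) rev t (+) 1 and u, where t and u are doubly
   alternating Baxter permutations of even sizes and (+) is the direct sum: the
   entries of value at least s(1) form a prefix of s (skew_prefix), and a
   doubly alternating Baxter permutation fixing 1 also fixes n, by the symmetry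
   under reverse-complement. Hence the permutations of size 2m are counted by
   the Catalan numbers C_m, and each of the three events s(1) = 1,
   s(1) = 2m - 1, s(2) = 2m - 1 is a condition on the sizes of t and u that
   leaves C_(m-1) permutations; finally C_(m-1) / C_m tends to 1/4. *)

Set Implicit Arguments.
Unset Strict Implicit.
Unset Printing Implicit Defensive.

Import Order.TTheory GRing.Theory Num.Theory.
Import numFieldNormedType.Exports.

(** * Doubly alternating Baxter permutations as functions on nat *)

Record good (n : nat) (f : nat -> nat) : Prop := Good {
  good_lt : forall i, i < n -> f i < n;
  good_inj : forall i j, i < n -> j < n -> f i = f j -> i = j;
  good_alt : forall i, i.+1 < n -> (f i < f i.+1) = ~~ odd i;
  good_alt_inv : forall i j, i < n -> j < n -> f j = (f i).+1 ->
    (i < j) = ~~ odd (f i);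
  good_3142 : forall i j k, i < j -> j < k -> k < n ->
    f j < f k -> f k < f i -> f i < f j.+1 -> False;
  good_2413 : forall i j k, i < j -> j < k -> k < n ->
    f j.+1 < f i -> f i < f k -> f k < f j -> False
}.

Lemma exists_last_step (Q : pred nat) c d :
  c < d -> Q c -> ~~ Q d -> exists2 j, c <= j < d & Q j && ~~ Q j.+1.
Proof.
move=> cd Qc; elim: d cd => // d IH cd Qd.
have [Qd'|nQd'] := boolP (Q d); first by exists d; rewrite ?Qd' //; lia.
have [dc|dc] := eqVneq d c; first by rewrite dc Qc in nQd'.
have [|j jd Qj] := IH _ nQd'; first lia.
by exists j => //; lia.
Qed.

Lemma inj_leq k l (f : nat -> nat) :
  (forall i, i < k -> f i < l) ->
  (forall i j, i < k -> j < k -> f i = f j -> i = j) -> k <= l.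
Proof.
move=> fl fi; rewrite -(size_iota 0 k) -(size_iota 0 l) -(size_map f).
apply: uniq_leq_size.
  rewrite map_inj_in_uniq ?iota_uniq // => i j; rewrite !mem_iota => ik jk.
  by apply: fi; lia.
move=> x /mapP[i]; rewrite !mem_iota => ik ->.
by have := fl i; lia.
Qed.

Lemma good_surj n f v : good n f -> v < n -> exists2 i, i < n & f i = v.
Proof.
move=> gf vn.
have [/mapP[i]|fv] := boolP (v \in [seq f i | i <- iota 0 n]).
  by rewrite mem_iota => ik ->; exists i.
suff : size (v :: [seq f i | i <- iota 0 n]) <= size (iota 0 n).
  by rewrite /= size_map ltnn.
apply: uniq_leq_size => [|x].
  rewrite /= fv map_inj_in_uniq ?iota_uniq // => i j; rewrite !mem_iota.
  exact: (good_inj gf).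
rewrite inE => /orP[/eqP ->|/mapP[i]]; first by rewrite mem_iota.
by rewrite !mem_iota => ik ->; have := good_lt gf (i := i); lia.
Qed.

Lemma eq_good n f g : (forall i, i < n -> f i = g i) -> good n f -> good n g.
Proof.
move=> fg [lt inj alt ialt b1 b2]; split.
- by move=> i ik; rewrite -fg //; apply: lt.
- by move=> i j ik jk; rewrite -!fg //; apply: inj.
- by move=> i ik; rewrite -!fg ?alt //; lia.
- by move=> i j ik jk; rewrite -!fg //; apply: ialt.
- move=> i j k ij jk kn; rewrite -!fg; try lia; exact: b1.
- move=> i j k ij jk kn; rewrite -!fg; try lia; exact: b2.
Qed.

(* Otherwise some ascent between c and d is the middle of a 3-14-2 with outer
   entries v + 1 and v. *)
Lemma good_no_return n f x y c d v : good n f -> f x = v.+1 -> f y = v ->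
  x < c -> c < d -> d < y -> y < n -> f c < v -> v.+1 < f d -> False.
Proof.
move=> gf fx fy xc cd dy yn fc fd.
have [||j jd /andP[fj fj1]] := @exists_last_step (fun j => f j < v) c d cd.
- exact: fc.
- by rewrite -leqNgt; lia.
have h1 := good_inj gf (i := j.+1) (j := x).
have h2 := good_inj gf (i := j.+1) (j := y).
apply: (good_3142 gf (i := x) (j := j) (k := y)); lia.
Qed.

Lemma first_below n f p :
  good n f -> p < n -> f p < f 0 -> exists q,
  [/\ 0 < q <= p, f q < f 0 & forall i, i < q -> f 0 <= f i].
Proof.
move=> gf pn fp; have ex : exists q, f q < f 0 by exists p.
exists (ex_minn ex); case: ex_minnP => q fq qmin; split=> //.
- by rewrite qmin // andbT; case: q fq {qmin} => //; rewrite ltnn.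
- by move=> i iq; rewrite leqNgt; apply/negP => /qmin; lia.
Qed.

(* Suppose f rises above f 0 again, first from p to p + 1, and let q be the
   first position below f 0. The window [q, p] has odd length 2 l + 1 and
   lies below f 0. Each of its l descents j yields an odd value v of the
   window, where v + 1 occurs weakly before j and v after j; these values are
   distinct. With f 0 - 1 they form l + 1 odd values, and the predecessors of
   those also lie in the window: too many values. *)
Lemma skew_prefix n f q r : good n f -> q < r -> r < n ->
  f q < f 0 -> f r < f 0.
Proof.
move=> gf qr rn fq; rewrite ltnNge; apply/negP => fr.
have inj := good_inj gf.
have fr0 : f 0 < f r by have := inj 0 r; lia.
have [|{fq}q0 [q0q fq0 qmin]] := first_below gf _ fq; first lia.
have ex : exists r', (q0 < r') && (f 0 < f r').
  by exists r; rewrite fr0; lia.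
have [[//|p] /andP[qp fp] pmin] := ex_minnP ex.
have {pmin ex}[pn pmin] :
    p.+1 < n /\ forall i, q0 < i -> i <= p -> f i <= f 0.
  split=> [|i qi ip]; first by have := pmin r; rewrite fr0; lia.
  by rewrite leqNgt; apply/negP => fi; have := pmin i; rewrite qi fi; lia.
have win i : q0 <= i <= p -> f i < f 0.
  have [-> //|iq] := eqVneq i q0.
  by move=> iqp; have := pmin i; have := inj i 0; lia.
have q_le i : f i < f 0 -> q0 <= i.
  by move=> fi; rewrite leqNgt; apply/negP => /qmin; lia.
have p_even : ~~ odd p.
  by rewrite -(good_alt gf) //; apply: ltn_trans fp; apply: win; lia.
have q_even : ~~ odd q0.
  have := good_alt gf (i := q0.-1); have := qmin q0.-1.
  by rewrite prednK; lia.
have f0n : f 0 < n by apply: (good_lt gf); lia.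
have [|x xn fx] := good_surj (v := (f 0).-1) gf; first lia.
have f0_even : ~~ odd (f 0).
  by have := good_alt_inv gf (i := x) (j := 0); lia.
(* The value [(f 0).-1] cannot come after [p]: with [f 0], [f p] and [f p.+1] it would form a
   3-14-2. *)
have xqp : q0 <= x <= p.
  rewrite q_le ?fx /=; last lia.
  rewrite leqNgt; apply/negP => px.
  have xp1 : x != p.+1 by apply/eqP => xp1; move: fp; rewrite -xp1 fx; lia.
  have fpx : f p != f x by apply/eqP => /inj; lia.
  by apply: (good_3142 gf (i := 0) (j := p) (k := x)) => //;
    have := win p; lia.
have desc j : odd j -> q0 < j -> j < p -> exists v,
    [/\ odd v, v.+1 < f 0, f j.+1 <= v < f j &
        exists x y, [/\ f x = v.+1, f y = v, q0 <= x <= j & j < y <= p]].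
  move=> jo qj jp.
  have fj : f j.+1 < f j.
    by have := good_alt gf (i := j); have := inj j j.+1; lia.
  have fj0 : f j < f 0 by apply: win; lia.
  (* Between [f j.+1], which occurs after [j], and [f j], which does not, some [v] occurs after [j]
     while [v.+1] does not. *)
  have [||v vj /andP[/asboolP[y yn fy] /asboolPn nx]] := @exists_last_step
      (fun u => `[< exists2 y, j < y < n & f y = u >]) _ _ fj.
  - by apply/asboolP; exists j.+1 => //; lia.
  - by apply/asboolPn => -[y yn] /inj; lia.
  have [|z zn fz] := good_surj (v := v.+1) gf; first lia.
  have zj : z <= j.
    by rewrite leqNgt; apply/negP => jz; apply: nx; exists z; lia.
  have qz : q0 <= z by apply: q_le; lia.
  exists v; split; try lia.
    by have := good_alt_inv gf (i := y) (j := z); lia.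
  exists z, y; split => //; first lia.
  (* Otherwise, between [v.+1] and [v], the entries would be below [v] at [j.+1] and above [v.+1] at
     [p.+1]. *)
  have [|py] := leqP y p; first lia.
  have yp1 : y != p.+1 by apply/eqP => yp1; move: fp; rewrite -yp1 fy; lia.
  have fjy : f j.+1 != f y by apply/eqP => /inj; lia.
  by case: (good_no_return gf fz fy (c := j.+1) (d := p.+1)); lia.
have [l pl] : exists l, p = q0 + l.*2 by exists (p - q0)./2; lia.
pose D t v := [/\ odd v, v.+1 < f 0,
    f (q0 + t.*2.+2) <= v < f (q0 + t.*2.+1) & exists x y,
    [/\ f x = v.+1, f y = v, q0 <= x <= q0 + t.*2.+1 &
        q0 + t.*2.+1 < y <= p]].
have [g gP] : exists g, forall t, t < l -> D t (g t).
  suff /boolp.choice[g] : forall t, exists v, t < l -> D t v by exists g.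
  move=> t; have [tl|] := ltnP t l; last by exists 0.
  have [|||v Dv] := desc (q0 + t.*2.+1); try lia.
  by exists v => _; rewrite /D addnS.
(* A value shared by two descents would be passed downwards at the first and exceeded again at the
   top of the second, which [good_no_return] forbids. *)
have g_lt t u : t < u -> u < l -> g t != g u.
  move=> tu ul; apply/eqP => gtu.
  have [|_ _ ft [x1 [y1 [fx1 fy1 x1t y1t]]]] := gP t; first lia.
  have [|_ _ fu [x2 [y2 [fx2 fy2 x2u y2u]]]] := gP u; first lia.
  have x12 : x1 = x2 by apply: inj; lia.
  have y12 : y1 = y2 by apply: inj; lia.
  have n1 : f (q0 + t.*2.+2) != f y1 by apply/eqP => /inj; lia.
  have n2 : f (q0 + u.*2.+1) != f x1 by apply/eqP => /inj; lia.
  case: (good_no_return gf fx1 fy1 (c := q0 + t.*2.+2) (d := q0 + u.*2.+1));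
    lia.
pose S := (f 0).-1 :: [seq g t | t <- iota 0 l].
pose V := [seq f i | i <- iota q0 l.*2.+1].
have memV y : q0 <= y <= p -> f y \in V.
  by move=> yqp; apply: map_f; rewrite mem_iota; lia.
have S_odd v : v \in S -> odd v /\ v < f 0.
  rewrite inE => /orP[/eqP ->|/mapP[t]]; first lia.
  by rewrite mem_iota => tl ->; have [|? ? _ _] := gP t; lia.
have SV v : v \in S -> v \in V.
  rewrite inE => /orP[/eqP ->|/mapP[t]]; first by rewrite -fx memV.
  rewrite mem_iota => tl ->; have [|? ? _ [x1 [y1 [_ <- ? ?]]]] := gP t.
    lia.
  by apply: memV; lia.
have S_uniq : uniq S.
  rewrite /= map_inj_in_uniq ?iota_uniq ?andbT.
    apply/mapP => -[t]; rewrite mem_iota => tl.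
    by have [|? ? _ _] := gP t; lia.
  move=> t u; rewrite !mem_iota => tl ul gtu; apply/eqP.
  have [tu|ut|//] := ltngtP t u; first by have := g_lt t u; lia.
  by have := g_lt u t; lia.
(* For odd [v] the even value [v.-1] stands to the left of [v], hence before [p]; being below [f 0],
   it does not stand before [q0]. *)
have predV v : v \in S -> v.-1 \in V.
  move=> vS; have [vo v0] := S_odd v vS.
  have [y yn fy] := good_surj (v := v.-1) gf (ltac:(lia)).
  have /mapP[z] := SV v vS; rewrite mem_iota => zqp vz.
  have := good_alt_inv gf (i := y) (j := z).
  by rewrite -fy => yz; apply: memV; have := q_le y; lia.
suff : size (S ++ map predn S) <= size V.
  by rewrite size_cat !size_map /= !size_map !size_iota; lia.
apply: uniq_leq_size => [|v]; last first.
  by rewrite mem_cat => /orP[/SV//|/mapP[u /predV uV ->]].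
rewrite cat_uniq; apply/and3P; split => //.
  apply/hasPn => v /mapP[u /S_odd[uo _] ->]; apply/negP => /S_odd[]; lia.
rewrite map_inj_in_uniq // => u v /S_odd[uo _] /S_odd[vo _]; lia.
Qed.

(** * Symmetry under reverse-complement *)

(** For even [n] the pair [i], [i.+1] is reflected to a pair whose lower member has the parity of
    [i], and its order is reversed twice. Each forbidden pattern is mapped to itself. *)
Lemma good_rev_compl n f : ~~ odd n -> good n f ->
  good n (fun i => n.-1 - f (n.-1 - i)).
Proof.
move=> ne gf; have lt := good_lt gf; have inj := good_inj gf.
have ltn i : i < n -> f (n.-1 - i) < n by move=> ik; apply: lt; clear -ik; lia.
have flip a b : n.-1 - a < n.-1 - b -> b < a by clear; lia.
split.
- by move=> i ik; have := ltn i ik; clear; lia.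
- move=> i j ik jk ij.
  have fij : f (n.-1 - i) = f (n.-1 - j).
    by have := ltn i ik; have := ltn j jk; clear -ij; lia.
  by have := inj _ _ _ _ fij; clear -ik jk; lia.
- move=> i ik; have := good_alt gf (i := n.-1 - i.+1).
  rewrite (_ : (n.-1 - i.+1).+1 = n.-1 - i); last by clear -ik; lia.
  have fi := ltn i (ltnW ik); have fi1 := ltn i.+1 ik.
  have ne1 : f (n.-1 - i) != f (n.-1 - i.+1).
    by apply/eqP => /inj; clear -ik; lia.
  by clear -ik ne fi fi1 ne1; lia.
- move=> i j ik jk ij; have fi := ltn i ik; have fj := ltn j jk.
  have := good_alt_inv gf (i := n.-1 - j) (j := n.-1 - i).
  by clear -ne ik jk ij fi fj; lia.
- move=> i j k ij jk kn /flip h1 /flip h2 /flip h3.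
  (* If [k] were [j.+1], the three inequalities would form a cycle. The gap keeps the reflected
     indices strictly increasing. *)
  have kj : j.+1 < k.
    rewrite ltn_neqAle jk andbT; apply/eqP => kE; move: h1 h2 h3; rewrite -kE.
    by clear; lia.
  have jE : (n.-1 - j.+1).+1 = n.-1 - j by clear -kj kn; lia.
  apply: (good_3142 gf (i := n.-1 - k) (j := n.-1 - j.+1) (k := n.-1 - i));
    rewrite ?jE //; clear -ij kj kn; lia.
- move=> i j k ij jk kn /flip h1 /flip h2 /flip h3.
  have kj : j.+1 < k.
    rewrite ltn_neqAle jk andbT; apply/eqP => kE; move: h1 h2 h3; rewrite -kE.
    by clear; lia.
  have jE : (n.-1 - j.+1).+1 = n.-1 - j by clear -kj kn; lia.
  apply: (good_2413 gf (i := n.-1 - k) (j := n.-1 - j.+1) (k := n.-1 - i));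
    rewrite ?jE //; clear -ij kj kn; lia.
Qed.

(** The reverse-complement ends with its maximum. If its first entry were positive, the later entry
    0 would force its end below the first entry, by [skew_prefix]. *)
Lemma good_head0 n f : ~~ odd n -> good n f -> f 0 = 0 -> f n.-1 = n.-1.
Proof.
move=> ne gf f0; have [n0|n_gt0] := leqP n 0.
  by rewrite (_ : n.-1 = 0) ?f0; lia.
have gg := good_rev_compl ne gf; have fn := good_lt gf (i := n.-1).
have [x xn /= gx] := good_surj gg n_gt0.
have xn1 : x != n.-1 by apply/eqP => xE; move: gx; rewrite xE subnn f0; lia.
have := skew_prefix gg (q := x) (r := n.-1).
by rewrite subnn f0 subn0; lia.
Qed.

Definition skewf p q (f g : nat -> nat) i :=
  if i < p then f i + q else g (i - p).

(** Shifting the inner block by one position and one value flips the parities in both alternation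
    conditions; reversing it compensates. *)
Definition wrapf n (f : nat -> nat) i :=
  if i == 0 then 0 else if i == n.+1 then n.+1 else (f (n - i)).+1.

(** Even sizes keep parities inside the blocks and put the descents at the junction, in positions
    and in values, at odd places. No forbidden pattern straddles the blocks, as neither is a skew
    sum. *)
Lemma good_skew p q f g : ~~ odd p -> ~~ odd q ->
  good p f -> good q g -> good (p + q) (skewf p q f g).
Proof.
move=> pe qe gf gg.
have ltf := good_lt gf; have injf := good_inj gf.
have ltg := good_lt gg; have injg := good_inj gg.
have sP i : i < p + q -> i < p /\ skewf p q f g i = f i + q \/
    p <= i /\ skewf p q f g i = g (i - p) /\ g (i - p) < q.
  move=> ipq; rewrite /skewf; case: ltnP => [ip|pi]; [by left|right].
  by split=> //; split=> //; apply: ltg; clear -pi ipq; lia.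
split.
- move=> i ipq; have [[ip ->]|[pi [-> gi]]] := sP i ipq.
    by have := ltf i ip; clear; lia.
  by clear -gi; lia.
- move=> i j ipq jpq; have [[ip ->]|[pi [-> gi]]] := sP i ipq;
    have [[jp ->]|[pj [-> gj]]] := sP j jpq => fij.
  + by apply: injf => //; clear -fij; lia.
  + by clear -fij gj; lia.
  + by clear -fij gi; lia.
  + by have := injg (i - p) (j - p) _ _ fij; clear -pi pj ipq jpq; lia.
- move=> i ipq; have [[ip ->]|[pi [-> gi]]] := sP i (ltnW ipq);
    have [[jp ->]|[pj [-> gj]]] := sP i.+1 ipq.
  + by have := good_alt gf jp; clear; lia.
  + by clear -pe ip pj gj; lia.
  + by clear -pi jp; lia.
  + have := good_alt gg (i := i - p); rewrite -subSn //.
    by clear -ipq pe pi; lia.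
- move=> i j ipq jpq; have [[ip ->]|[pi [-> gi]]] := sP i ipq;
    have [[jp ->]|[pj [-> gj]]] := sP j jpq => fij.
  + have := good_alt_inv gf ip jp; clear -fij qe; lia.
  + by clear -fij gj; lia.
  + have -> : g (i - p) = q.-1 by clear -fij gi; lia.
    by clear -qe pi jp gi; lia.
  + by have := good_alt_inv gg (i := i - p) (j := j - p) _ _ fij;
      clear -pi pj ipq jpq; lia.
- move=> i j k ij jk kn.
  have [ipq jpq j1pq] : [/\ i < p + q, j < p + q & j.+1 < p + q].
    by clear -ij jk kn; split; lia.
  have [[kp ->]|[pk [-> gk]]] := sP k kn.
    have sE l : l <= k -> skewf p q f g l = f l + q.
      by move=> lk; rewrite /skewf (leq_ltn_trans lk kp).
    rewrite !sE // ?ltn_add2r; try by clear -ij jk; lia.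
    exact: (good_3142 gf).
  have [[ip ->]|[pi [-> gi]]] := sP i ipq;
    have [[jp ->]|[pj [-> gj]]] := sP j jpq.
  + by clear -gk; lia.
  + have [[j1p _]|[_ [-> gj1]]] := sP j.+1 j1pq; last by clear -gj1; lia.
    by clear -j1p pj; lia.
  + by clear -ij jp pi; lia.
  + have -> : skewf p q f g j.+1 = g (j - p).+1.
      by rewrite /skewf ltnNge (leq_trans pj (leqnSn j)) /= subSn.
    by apply: (good_3142 gg); clear -ij pi jk kn pk; lia.
- move=> i j k ij jk kn.
  have [ipq jpq j1pq] : [/\ i < p + q, j < p + q & j.+1 < p + q].
    by clear -ij jk kn; split; lia.
  have [[kp ->]|[pk [-> gk]]] := sP k kn.
    have sE l : l <= k -> skewf p q f g l = f l + q.
      by move=> lk; rewrite /skewf (leq_ltn_trans lk kp).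
    rewrite !sE // ?ltn_add2r; try by clear -ij jk; lia.
    exact: (good_2413 gf).
  have [[ip ->]|[pi [-> gi]]] := sP i ipq;
    have [[jp ->]|[pj [-> gj]]] := sP j jpq.
  + by clear -gk; lia.
  + by clear -gk; lia.
  + by clear -ij jp pi; lia.
  + have -> : skewf p q f g j.+1 = g (j - p).+1.
      by rewrite /skewf ltnNge (leq_trans pj (leqnSn j)) /= subSn.
    by apply: (good_2413 gg); clear -ij pi jk kn pk; lia.
Qed.

(** Reversal exchanges 3-14-2 and 2-41-3, so each case calls on the other. The two ends lie in no
    pattern, whose outer entries are neither its minimum nor its maximum. *)
Lemma good_wrap n f : ~~ odd n -> good n f -> good n.+2 (wrapf n f).
Proof.
move=> ne gf; have lt := good_lt gf; have inj := good_inj gf.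
have wP i : i < n.+2 -> [\/ i = 0 /\ wrapf n f i = 0,
    i = n.+1 /\ wrapf n f i = n.+1 |
    0 < i <= n /\ (wrapf n f i = (f (n - i)).+1 /\ f (n - i) < n)].
  rewrite /wrapf => ik; case: eqVneq => [->|i0]; first by constructor 1.
  case: eqVneq => [->|i1]; first by constructor 2.
  constructor 3; split; first by clear -ik i0 i1; lia.
  by split=> //; apply: lt; clear -ik i0 i1; lia.
split.
- move=> i ik; have [[_ ->]|[_ ->]|[_ [-> fi]]] := wP i ik => //.
  by clear -fi; lia.
- move=> i j ik jk; have [[i0 ->]|[i0 ->]|[i0 [-> fi]]] := wP i ik;
    have [[j0 ->]|[j0 ->]|[j0 [-> fj]]] := wP j jk => fij;
    try by [move: fij | rewrite i0 j0]; try by clear -fij fi; lia.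
  + by clear -fij fj; lia.
  + have /inj : f (n - i) = f (n - j) by case: fij.
    by clear -i0 j0; lia.
- move=> i ik; have [[i0 ->]|[i0 ->]|[i0 [-> fi]]] := wP i (ltnW ik);
    have [[j0 ->]|[j0 ->]|[j0 [-> fj]]] := wP i.+1 ik;
    try by clear -i0 j0 ik; lia.
  + by clear -fi i0 j0 ne; lia.
  + have := good_alt gf (i := n - i.+1).
    rewrite (_ : (n - i.+1).+1 = n - i); last by clear -j0; lia.
    have nij : f (n - i) != f (n - i.+1).
      by apply/eqP => /inj; clear -i0 j0; lia.
    by clear -ne i0 j0 nij; lia.
- move=> i j ik jk; have [[i0 ->]|[i0 ->]|[i0 [-> fi]]] := wP i ik;
    have [[j0 ->]|[j0 ->]|[j0 [-> fj]]] := wP j jk => fij;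
    try by move: fij.
  + by rewrite i0 j0.
  + by rewrite i0; clear -j0; lia.
  + by clear -fij; lia.
  + by clear -fij fj; lia.
  + by clear -fij i0 j0 fi ne; lia.
  + have nij : i != j by apply/eqP => ij; move: fij; rewrite ij; clear; lia.
    have := good_alt_inv gf (i := n - i) (j := n - j).
    by clear -ne fij i0 j0 nij; lia.
- move=> i j k ij jk kn h1 h2 h3.
  have kj : j.+1 < k.
    rewrite ltn_neqAle jk andbT; apply/eqP => kE; move: h1 h2 h3; rewrite -kE.
    by clear; lia.
  have ik : 0 < i <= n /\ k <= n.
    have [ilt jlt] : i < n.+2 /\ j < n.+2 by clear -ij jk kn; lia.
    have [[i0 iE]|[i0 iE]|[i0 [iE fi]]] := wP i ilt.
    + by move: h2; rewrite iE.
    + by clear -i0 ij jk kn; lia.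
    have [[k0 kE]|[k0 kE]|[k0 [kE fk]]] := wP k kn.
    + by clear -k0 jk; lia.
    + by move: h2; rewrite iE kE; clear -fi; lia.
    + by clear -i0 k0; lia.
  have wE l : 0 < l -> l <= n -> wrapf n f l = (f (n - l)).+1.
    by rewrite /wrapf => l0 ln; rewrite !ifF //; clear -l0 ln; lia.
  have jE : (n - j.+1).+1 = n - j by clear -kj ik; lia.
  move: h1 h2 h3; rewrite !wE ?ltnS; try by clear -ij kj ik; lia.
  move=> h1 h2 h3.
  by apply: (good_2413 gf (i := n - k) (j := n - j.+1) (k := n - i));
    rewrite ?jE //; clear -ij kj ik; lia.
- move=> i j k ij jk kn h1 h2 h3.
  have kj : j.+1 < k.
    rewrite ltn_neqAle jk andbT; apply/eqP => kE; move: h1 h2 h3; rewrite -kE.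
    by clear; lia.
  have ik : 0 < i <= n /\ k <= n.
    have [ilt jlt] : i < n.+2 /\ j < n.+2 by clear -ij jk kn; lia.
    have [[i0 iE]|[i0 iE]|[i0 [iE fi]]] := wP i ilt.
    + by move: h1; rewrite iE.
    + by clear -i0 ij jk kn; lia.
    have [[k0 kE]|[k0 kE]|[k0 [kE fk]]] := wP k kn.
    + by clear -k0 jk; lia.
    + have [[_ jE]|[_ jE]|[_ [jE fj]]] := wP j jlt; move: h3; rewrite kE jE //.
        by rewrite ltnn.
      by clear -fj; lia.
    + by clear -i0 k0; lia.
  have wE l : 0 < l -> l <= n -> wrapf n f l = (f (n - l)).+1.
    by rewrite /wrapf => l0 ln; rewrite !ifF //; clear -l0 ln; lia.
  have jE : (n - j.+1).+1 = n - j by clear -kj ik; lia.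
  move: h1 h2 h3; rewrite !wE ?ltnS; try by clear -ij kj ik; lia.
  move=> h1 h2 h3.
  by apply: (good_3142 gf (i := n - k) (j := n - j.+1) (k := n - i));
    rewrite ?jE //; clear -ij kj ik; lia.
Qed.

(** * Cutting into blocks and unwrapping *)

Lemma good_prefix p q h : ~~ odd q -> good (p + q) h ->
  (forall i, i < p -> q <= h i) -> good p (fun i => h i - q).
Proof.
move=> qe gh hq; have lt := good_lt gh; have inj := good_inj gh.
have lep i : i < p -> i < p + q by clear; lia.
split.
- move=> i ip; have := lt i (lep i ip); have := hq i ip; clear -ip; lia.
- move=> i j ip jp hij; apply: inj; try exact: lep.
  by have := hq i ip; have := hq j jp; clear -hij; lia.
- move=> i ip; rewrite -(good_alt gh (lep _ ip)).
  by have := hq i (ltnW ip); have := hq _ ip; clear; lia.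
- move=> i j ip jp hij.
  have := good_alt_inv gh (lep i ip) (lep j jp).
  by have := hq i ip; have := hq j jp; clear -hij qe; lia.
- move=> i j k ij jk kp h1 h2 h3.
  have := good_3142 gh ij jk (lep k kp).
  have := hq i (ltn_trans ij (ltn_trans jk kp)); have := hq j (ltn_trans jk kp).
  have := hq k kp; have := hq j.+1 (leq_ltn_trans jk kp).
  by clear -h1 h2 h3; lia.
- move=> i j k ij jk kp h1 h2 h3.
  have := good_2413 gh ij jk (lep k kp).
  have := hq i (ltn_trans ij (ltn_trans jk kp)); have := hq j (ltn_trans jk kp).
  have := hq k kp; have := hq j.+1 (leq_ltn_trans jk kp).
  by clear -h1 h2 h3; lia.
Qed.

Lemma good_suffix p q h : ~~ odd p -> good (p + q) h ->
  (forall i, i < q -> h (p + i) < q) -> good q (fun i => h (p + i)).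
Proof.
move=> pe gh hq; have inj := good_inj gh.
split => //.
- by move=> i j ip jp; have := inj (p + i) (p + j); clear -ip jp; lia.
- move=> i ip; have := good_alt gh (i := p + i); rewrite addnS.
  by clear -ip pe; lia.
- move=> i j ip jp hij.
  by have := good_alt_inv gh (i := p + i) (j := p + j) _ _ hij;
    clear -ip jp; lia.
- move=> i j k ij jk kp h1 h2 h3; rewrite addnS in h3.
  by apply: (good_3142 gh _ _ _ h1 h2 h3); clear -ij jk kp; lia.
- move=> i j k ij jk kp h1 h2 h3; rewrite addnS in h1.
  by apply: (good_2413 gh _ _ _ h1 h2 h3); clear -ij jk kp; lia.
Qed.

(** The value before [h 0] stands to its right, hence is odd. Entries before the first position [q]
    below [h 0] are at least [h 0], later ones are smaller by [skew_prefix]; two injections then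
    force [q = n - h 0]. *)
Lemma good_split n h : 0 < n -> good n h ->
  [/\ ~~ odd (h 0), h 0 < n, forall i, i < n - h 0 -> h 0 <= h i &
      forall i, i < h 0 -> h (n - h 0 + i) < h 0].
Proof.
move=> n0 gh; have lt := good_lt gh; have inj := good_inj gh.
have h0n := lt 0 n0.
have [a0|a_gt0] := posnP (h 0); first by rewrite a0; split.
have a_even : ~~ odd (h 0).
  have [|x xn hx] := good_surj (v := (h 0).-1) gh; first by clear -h0n; lia.
  by have := good_alt_inv gh (i := x) (j := 0); clear -xn hx n0 a_gt0; lia.
have [x xn hx] := good_surj gh n0.
have [|q [q_gt0 hq qmin]] := first_below gh xn; first by rewrite hx.
have qn : q < n by clear -q_gt0 xn; lia.
have after i : q <= i -> i < n -> h i < h 0.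
  rewrite leq_eqVlt => /orP[/eqP <- //|qi ik].
  exact: (skew_prefix gh qi ik hq).
have le1 : q <= n - h 0.
  apply: (inj_leq (f := fun i => h i - h 0)) => [i iq|i j iq jq hij].
    have := qmin i iq; have := lt i (ltn_trans iq qn); clear; lia.
  apply: inj; try exact: ltn_trans qn.
  by have := qmin i iq; have := qmin j jq; clear -hij; lia.
have le2 : n - q <= h 0.
  apply: (inj_leq (f := fun i => h (q + i))) => [i iq|i j iq jq hij].
    by apply: after; clear -iq; lia.
  by have := inj _ _ _ _ hij; clear -iq jq; lia.
have qE : n - h 0 = q by clear -le1 le2 h0n qn; lia.
by rewrite qE; split => // i ia; apply: after; clear -ia qE h0n; lia.
Qed.

Lemma good_unwrap n h : ~~ odd n -> good n.+2 h -> h 0 = 0 -> h n.+1 = n.+1 ->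
  good n (fun i => (h (n - i)).-1).
Proof.
move=> ne gh h0 h1; have lt := good_lt gh; have inj := good_inj gh.
(* The ends use up the values 0 and [n.+1], so [.-1] does not truncate inside. *)
have bd i : 0 < i -> i <= n -> 0 < h i <= n.
  move=> i0 ik; have ik2 : i < n.+2 by clear -ik; lia.
  have := lt i ik2; have n0 : h i != 0.
    by rewrite -h0; apply/eqP => /inj; clear -i0 ik; lia.
  have n1 : h i != n.+1.
    by rewrite -h1; apply/eqP => /inj; clear -i0 ik; lia.
  by clear -n0 n1; lia.
have bd' i : i < n -> 0 < h (n - i) <= n.
  by move=> ik; apply: bd; clear -ik; lia.
split.
- by move=> i ik; have := bd' i ik; clear; lia.
- move=> i j ik jk hij; have hij' : h (n - i) = h (n - j).
    by have := bd' i ik; have := bd' j jk; clear -hij; lia.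
  by have := inj _ _ _ _ hij'; clear -ik jk; lia.
- move=> i ik; have := good_alt gh (i := n - i.+1).
  rewrite (_ : (n - i.+1).+1 = n - i); last by clear -ik; lia.
  have nij : h (n - i) != h (n - i.+1).
    by apply/eqP => /inj; clear -ik; lia.
  have := bd' i (ltnW ik); have := bd' _ ik; clear -nij ik ne; lia.
- move=> i j ik jk hij.
  have bi := bd' i ik; have bj := bd' j jk.
  have := good_alt_inv gh (i := n - i) (j := n - j).
  have nij : i != j by apply/eqP => ij; move: hij; rewrite ij; clear; lia.
  by clear -ik jk hij bi bj ne nij; lia.
- move=> i j k ij jk kn h2 h3 h4.
  have kj : j.+1 < k.
    rewrite ltn_neqAle jk andbT; apply/eqP => kE; move: h2 h3 h4; rewrite -kE.
    by clear; lia.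
  have jE : (n - j.+1).+1 = n - j by clear -kj kn; lia.
  have := good_2413 gh (i := n - k) (j := n - j.+1) (k := n - i).
  have := bd' k kn; have := bd' j (ltn_trans jk kn).
  have := bd' i (ltn_trans ij (ltn_trans jk kn)).
  have := bd' _ (ltn_trans kj kn).
  by rewrite jE; clear -ij kj kn h2 h3 h4; lia.
- move=> i j k ij jk kn h2 h3 h4.
  have kj : j.+1 < k.
    rewrite ltn_neqAle jk andbT; apply/eqP => kE; move: h2 h3 h4; rewrite -kE.
    by clear; lia.
  have jE : (n - j.+1).+1 = n - j by clear -kj kn; lia.
  have := good_3142 gh (i := n - k) (j := n - j.+1) (k := n - i).
  have := bd' k kn; have := bd' j (ltn_trans jk kn).
  have := bd' i (ltn_trans ij (ltn_trans jk kn)).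
  have := bd' _ (ltn_trans kj kn).
  by rewrite jE; clear -ij kj kn h2 h3 h4; lia.
Qed.

(** * One-line words and the decomposition *)

(** Words put permutations of all sizes into one type, so that blocks can be joined and cut without
    casts. *)
Definition word n (s : 'S_n) : seq nat := [seq val (s i) | i <- enum 'I_n].

Lemma size_word n (s : 'S_n) : size (word s) = n.
Proof. by rewrite size_map size_enum_ord. Qed.

Lemma nth_word n (s : 'S_n) (i : 'I_n) : nth 0 (word s) i = s i.
Proof. by rewrite (nth_map i) ?size_enum_ord // nth_ord_enum. Qed.

Lemma word_inj n : injective (@word n).
Proof.
move=> s t st; apply/permP => i; apply: val_inj.
by rewrite /= -!nth_word st.
Qed.

Lemma dabP n (s : 'S_n) :
  reflect (good n (nth 0 (word s))) (s \in doubly_alternating_Baxter n).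
Proof.
have wE i (ik : i < n) : nth 0 (word s) i = s (Ordinal ik).
  by rewrite -(nth_word s (Ordinal ik)).
rewrite inE; apply: (iffP and3P) => [[/negP b /forallP a /forallP ai]|gs].
- split.
  + by move=> i ik; rewrite wE.
  + by move=> i j ik jk; rewrite !wE => /val_inj/perm_inj[].
  + move=> i ik; have /forallP/(_ (Ordinal ik)) := a (Ordinal (ltnW ik)).
    rewrite eqxx /= -!wE; case: (odd i) => // /ltnW; rewrite leqNgt.
    exact: negbTE.
  + move=> i j ik jk; rewrite !wE => sij.
    have /forallP/(_ (s (Ordinal jk))) := ai (s (Ordinal ik)).
    rewrite sij eqxx /= !permK /=; case: (odd _) => // /ltnW; rewrite leqNgt.
    exact: negbTE.
  + move=> i j k ij jk kn; have jn := ltn_trans jk kn.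
    have iN := ltn_trans ij jn.
    have j1n := leq_ltn_trans jk kn; rewrite !wE => h1 h2 h3; apply: b.
    apply/existsP; exists (Ordinal iN).
    apply/existsP; exists (Ordinal jn); apply/existsP; exists (Ordinal kn).
    by apply/existsP; exists (Ordinal j1n); rewrite /= ij jk eqxx h1 h2 h3 orbT.
  + move=> i j k ij jk kn; have jn := ltn_trans jk kn.
    have iN := ltn_trans ij jn.
    have j1n := leq_ltn_trans jk kn; rewrite !wE => h1 h2 h3; apply: b.
    apply/existsP; exists (Ordinal iN).
    apply/existsP; exists (Ordinal jn); apply/existsP; exists (Ordinal kn).
    by apply/existsP; exists (Ordinal j1n); rewrite /= ij jk eqxx h1 h2 h3.
- split.
  + apply/negP => /existsP[i /existsP[j /existsP[k /existsP[j1]]]].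
    case/and4P => ij jk /eqP jj1; rewrite -!nth_word jj1.
    case/orP => /and3P[h1 h2 h3].
      exact: (good_2413 gs ij jk (ltn_ord k)).
    exact: (good_3142 gs ij jk (ltn_ord k)).
  + apply/forallP => i; apply/forallP => i1; apply/implyP => /eqP ii1.
    have i1n := ltn_ord i1; rewrite ii1 in i1n.
    have := good_alt gs i1n; rewrite -!nth_word ii1.
    have := good_inj gs (ltnW i1n) i1n; case: (odd i); lia.
  + apply/forallP => v; apply/forallP => v1; apply/implyP => /eqP vv1.
    have := good_alt_inv gs (ltn_ord ((s^-1)%g v)) (ltn_ord ((s^-1)%g v1)).
    rewrite !nth_word !permKV => /(_ vv1).
    have : (s^-1)%g v != (s^-1)%g v1.
      by rewrite (inj_eq perm_inj); apply/eqP => vE; rewrite vE in vv1; lia.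
    rewrite -(inj_eq val_inj) /=; case: (odd v); lia.
Qed.

Definition words n : seq (seq nat) :=
  [seq word s | s <- enum (doubly_alternating_Baxter n)].

Lemma words_uniq n : uniq (words n).
Proof. by rewrite map_inj_uniq ?enum_uniq //; apply: word_inj. Qed.

Lemma wordsP n w :
  reflect (size w = n /\ good n (nth 0 w)) (w \in words n).
Proof.
apply: (iffP mapP) => [[s]|[<- gw]].
  by rewrite mem_enum => /dabP gs ->; rewrite size_word.
have lt (i : 'I_(size w)) : nth 0 w i < size w by apply: (good_lt gw).
have inj : injective (fun i => Ordinal (lt i)).
  move=> i j /(congr1 val) /= wij; apply: val_inj.
  exact: (good_inj gw (ltn_ord i) (ltn_ord j)).
have wE : w = word (perm inj).
  apply: (@eq_from_nth _ 0); first by rewrite size_word.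
  by move=> i ik; rewrite (nth_word _ (Ordinal ik)) permE.
by exists (perm inj) => //; rewrite mem_enum; apply/dabP; rewrite -wE.
Qed.

(* With one-line words, skew s t is the skew sum of s and t, and wrap s is
   the direct sum of 1, the reversal of s, and 1. *)
Definition skew (s t : seq nat) := [seq x + size t | x <- s] ++ t.

Definition wrap (s : seq nat) := 0 :: rcons (map succn (rev s)) (size s).+1.

Lemma size_wrap s : size (wrap s) = (size s).+2.
Proof. by rewrite /= size_rcons size_map size_rev. Qed.

Lemma size_skew s t : size (skew s t) = size s + size t.
Proof. by rewrite size_cat size_map. Qed.

Lemma nth_skew s t i : nth 0 (skew s t) i =
  skewf (size s) (size t) (nth 0 s) (nth 0 t) i.
Proof.
rewrite nth_cat size_map /skewf; case: ifP => // si.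
by rewrite (nth_map 0).
Qed.

Lemma nth_wrap s i : i < (size s).+2 ->
  nth 0 (wrap s) i = wrapf (size s) (nth 0 s) i.
Proof.
rewrite /wrapf; case: i => //= i is_.
rewrite nth_rcons size_map size_rev eqSS.
case: (ltngtP i (size s)) is_ => // [si _|]; last lia.
by rewrite (nth_map 0) ?size_rev // nth_rev.
Qed.

(** * Unique decomposition into grafts *)

Definition graft s t := skew (wrap s) t.

Lemma size_graft s t : size (graft s t) = (size s).+2 + size t.
Proof. by rewrite size_skew size_wrap. Qed.

Lemma graft_inj s t s' t' : size t = size t' ->
  graft s t = graft s' t' -> s = s' /\ t = t'.
Proof.
move=> tt' st; have ss' : size s = size s'.
  by have := congr1 size st; rewrite !size_graft; lia.
move/eqP: st; rewrite eqseq_cat ?size_map ?size_wrap ?ss' // tt'.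
case/andP => /eqP/inj_map wss' /eqP ->; split=> //.
have /wss'[] : injective (addn^~ (size t')) by move=> x y; lia.
by move/rcons_inj => -[/(inj_map succn_inj)/(can_inj revK)].
Qed.

Lemma mem_graft k m s t : s \in words (2 * k) -> t \in words (2 * m) ->
  graft s t \in words (2 * (k + m).+1).
Proof.
move=> /wordsP[ss gs] /wordsP[st gt]; apply/wordsP.
have nE : 2 * (k + m).+1 = (2 * k).+2 + 2 * m by lia.
rewrite size_graft ss st nE; split=> //.
have gw : good (2 * k).+2 (nth 0 (wrap s)).
  apply: (eq_good (f := wrapf (2 * k) (nth 0 s))); last first.
    by apply: good_wrap gs; lia.
  by move=> i ik; rewrite nth_wrap ss.
apply: eq_good (good_skew _ _ gw gt); try lia.
by move=> i ik; rewrite nth_skew size_wrap ss st.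
Qed.

(** [good_split] cuts the word at a place given by its first entry. The first block, lowered, starts
    with 0, so by [good_head0] it ends with its maximum and is a wrap. *)
Lemma graft_dec m w : w \in words (2 * m.+1) -> exists k s t,
  [/\ k <= m, s \in words (2 * k), t \in words (2 * (m - k)) & w = graft s t].
Proof.
move=> /wordsP[sw]; set n := 2 * m.+1; set h := nth 0 w => gh.
have [a_even h0n pre suf] := good_split (n := n) isT gh.
have [p pE] : exists p, n - h 0 = (2 * p).+2.
  by exists (m - (h 0)./2); move: a_even h0n; rewrite /n; lia.
have nE : (2 * p).+2 + h 0 = n by rewrite -pE subnK // ltnW.
rewrite pE in pre suf; rewrite -nE in gh.
have gs := good_suffix (p := (2 * p).+2) (q := h 0) (ltac:(lia)) gh suf.
have gp := good_prefix a_even gh pre.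
have hp : h (2 * p).+1 - h 0 = (2 * p).+1.
  by apply: (good_head0 (n := (2 * p).+2) _ gp); lia.
have gu := good_unwrap (n := 2 * p) (ltac:(lia)) gp (subnn _) hp.
exists p, (mkseq (fun i => (h (2 * p - i) - h 0).-1) (2 * p)).
exists (mkseq (fun i => h ((2 * p).+2 + i)) (h 0)).
have h0E : 2 * (m - p) = h 0 by move: nE; rewrite /n; lia.
split.
- by move: nE; rewrite /n; lia.
- apply/wordsP; rewrite size_mkseq; split=> //.
  by apply: eq_good gu => i ik; rewrite nth_mkseq.
- apply/wordsP; rewrite size_mkseq h0E; split=> //.
  by apply: eq_good gs => i ik; rewrite nth_mkseq.
apply: (@eq_from_nth _ 0); first by rewrite size_graft !size_mkseq nE.
move=> i; rewrite sw -/n -nE => ik.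
rewrite nth_skew size_wrap !size_mkseq /skewf.
case: ltnP => pi; last by rewrite nth_mkseq ?subnKC //; lia.
rewrite nth_wrap ?size_mkseq // /wrapf -/h.
case: eqVneq => [->//|i0]; case: eqVneq => [->|i1].
  by have := pre (2 * p).+1 (ltnSn _); move: hp; lia.
rewrite nth_mkseq; last lia.
rewrite (_ : 2 * p - (2 * p - i) = i); last lia.
have h0i : h i != h 0.
  by apply/eqP => /(good_inj gh); lia.
by have := pre i pi; lia.
Qed.

(** [graft_dec] gives existence. For uniqueness, the first entry of a graft is the size of its
    second component, which recovers [k]; then [graft_inj] applies. *)
Lemma perm_words m : perm_eq (words (2 * m.+1))
  [seq graft st.1 st.2 | k <- iota 0 m.+1,
     st <- [seq (s, t) | s <- words (2 * k), t <- words (2 * (m - k))]].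
Proof.
apply: uniq_perm; first exact: words_uniq.
  apply: allpairs_uniq_dep; first exact: iota_uniq.
    move=> k _; apply: allpairs_uniq; try exact: words_uniq.
    by case=> ? ? [].
  move=> x y /allpairsPdep[k [st [kI + ->]]] /allpairsPdep[k' [st' [kI' + ->]]].
  move=> /allpairsP[[s t] /= [sI tI ->]] /allpairsP[[s' t'] /= [sI' tI' ->]].
  move=> eq_graft.
  have [[ss gs] [tt gt]] := (wordsP _ _ sI, wordsP _ _ tI).
  have [[ss' gs'] [tt' gt']] := (wordsP _ _ sI', wordsP _ _ tI').
  have kk' : k = k'.
    have := congr1 (nth 0 ^~ 0) eq_graft; rewrite /= tt tt' !add0n.
    by move: kI kI'; rewrite !mem_iota; lia.
  rewrite -kk' in tt' *; rewrite -tt' in tt.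
  by have [-> ->] := graft_inj tt eq_graft.
move=> w; apply/idP/allpairsPdep => [/graft_dec[k [s [t [km sI tI ->]]]]|].
  exists k, (s, t); split=> //; first by rewrite mem_iota; lia.
  by apply/allpairsP; exists (s, t).
case=> k [st [kI /allpairsP[[s t] /= [sI tI ->]] ->]] /=.
have := mem_graft sI tI; rewrite subnKC //.
by move: kI; rewrite mem_iota; lia.
Qed.

(** With 0/1 functions for [F], this recursion serves the events as well as the total count. *)
Lemma sum_words m (F : seq nat -> nat) :
  \sum_(w <- words (2 * m.+1)) F w =
  \sum_(0 <= k < m.+1) \sum_(s <- words (2 * k))
     \sum_(t <- words (2 * (m - k))) F (graft s t).
Proof.
rewrite (perm_big _ (perm_words m)) big_allpairs_dep /index_iota subn0.
by apply: eq_bigr => k _; rewrite big_allpairs.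
Qed.

(** * Counting and asymptotics *)

Definition dab_count m := size (words (2 * m)).

Lemma dab_count0 : dab_count 0 = 1.
Proof.
suff /perm_size : perm_eq (words 0) [:: [::]] by [].
apply: uniq_perm => [||w]; rewrite ?words_uniq // inE.
apply/wordsP/eqP => [[]|->]; first by case: w.
by split=> //; split.
Qed.

Lemma sum_words_left m (F : seq nat -> nat) (G : nat -> seq nat -> nat) :
  (forall k s t, k <= m -> s \in words (2 * k) -> t \in words (2 * (m - k)) ->
     F (graft s t) = G k s) ->
  \sum_(w <- words (2 * m.+1)) F w =
  \sum_(0 <= k < m.+1) (\sum_(s <- words (2 * k)) G k s) * dab_count (m - k).
Proof.
move=> FG; rewrite sum_words; apply: eq_big_nat => k /andP[_ km].
rewrite big_distrl /=; apply: eq_big_seq => s sI.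
under eq_big_seq => t tI do rewrite (FG k s t) //.
by rewrite big_const_seq count_predT iter_addn_0 mulnC.
Qed.

Lemma dab_count_rec m :
  dab_count m.+1 = \sum_(0 <= k < m.+1) dab_count k * dab_count (m - k).
Proof.
rewrite {1}/dab_count -sum1_size (sum_words_left (G := fun _ _ => 1)) //.
by apply: eq_bigr => k _; rewrite sum1_size.
Qed.

(** Only [k = m] contributes, where [t] is empty and [s] arbitrary. *)
Lemma sum_words_top m (F : seq nat -> nat) :
  (forall k s t, k <= m -> s \in words (2 * k) -> t \in words (2 * (m - k)) ->
     F (graft s t) = (k == m)) ->
  \sum_(w <- words (2 * m.+1)) F w = dab_count m.
Proof.
move=> Fm; rewrite (sum_words_left (G := fun k _ => (k == m) : nat)) //.
rewrite big_nat_recr //= big_nat_cond big1 => [|k /andP[/andP[_ km] _]].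
  by rewrite eqxx sum1_size subnn dab_count0 muln1.
by rewrite ltn_eqF // big1.
Qed.

Lemma sum_head0 m :
  \sum_(w <- words (2 * m.+1)) (nth 0 w 0 == 0) = dab_count m.
Proof.
apply: sum_words_top => k s t km sI /wordsP[st _].
by rewrite /= add0n st; lia.
Qed.

(** The first entry is the size of the second component, which is [2 * m] exactly when the wrapped
    one is empty. *)
Lemma sum_head_max m :
  \sum_(w <- words (2 * m.+1)) (nth 0 w 0 == 2 * m) = dab_count m.
Proof.
rewrite (sum_words_left (G := fun k _ => (k == 0) : nat)) => [|k s t km sI].
  rewrite big_nat_recl // sum1_size -/(dab_count 0) dab_count0 mul1n subn0.
  by rewrite [X in _ + X]big1 ?addn0 // => k _; rewrite big1.
by move=> /wordsP[st _]; rewrite /= add0n st; lia.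
Qed.

(** A nonempty second component holds the last entry and lies below the first block, so it has to be
    empty. *)
Lemma sum_last_max m :
  \sum_(w <- words (2 * m.+1)) (nth 0 w (2 * m).+1 == (2 * m).+1) =
  dab_count m.
Proof.
apply: sum_words_top => k s t km /wordsP[ss gs] /wordsP[st gt].
rewrite nth_skew size_wrap ss st /skewf; case: ltnP => mk.
  have mE : k = m by lia.
  by rewrite nth_wrap ss mE // /wrapf eqxx subnn addn0 !eqxx.
have := good_lt gt (i := (2 * m).+1 - (2 * k).+2); lia.
Qed.

(** By the reversal in [wrap], the second entry comes from the last entry of [s] and has the
    required value when that is the maximum of a nonempty [s]. [sum_last_max] counts such [s], and
    the Catalan convolution reappears. *)
Lemma sum_second m :
  \sum_(w <- words (2 * m.+2)) (nth 0 w 1 == 2 * m.+1) = dab_count m.+1.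
Proof.
rewrite (sum_words_left (G := fun k s =>
  (0 < k) && (nth 0 s (2 * k).-1 == (2 * k).-1) : nat)) => [|k s t km].
  rewrite big_nat_recl // big1 // mul0n add0n dab_count_rec.
  apply: eq_bigr => k _; rewrite subSS -(sum_last_max k); congr (_ * _).
  by apply: eq_bigr => s _; rewrite (_ : (2 * k.+1).-1 = (2 * k).+1) //; lia.
move=> /wordsP[ss gs] /wordsP[st gt].
rewrite nth_skew size_wrap ss st /skewf nth_wrap ss // /wrapf eqSS /=.
have [->|k_gt0] := posnP k; first by rewrite eqxx; lia.
by rewrite ifF; [rewrite subn1|]; lia.
Qed.

Lemma card_dab m : #|doubly_alternating_Baxter (2 * m)| = dab_count m.
Proof. by rewrite /dab_count size_map cardE. Qed.

Lemma card_sends n i j : i < n ->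
  #|[set s in doubly_alternating_Baxter n | sends s i.+1 j.+1]| =
  \sum_(w <- words n) (nth 0 w i == j).
Proof.
move=> ik; rewrite big_map big_enum /= -sum1dep_card big_mkcondr /=.
apply: eq_bigr => s _; rewrite (nth_word s (Ordinal ik)).
suff -> : sends s i.+1 j.+1 = (s (Ordinal ik) == j :> nat) by case: eqP.
apply/existsP/eqP => [[k /andP[/eqP[ki] /eqP[<-]]]|<-].
  by congr (val (s _)); apply: val_inj.
by exists (Ordinal ik); rewrite !eqxx.
Qed.

(** * Catalan numbers and the limit of their ratios *)

Local Open Scope classical_set_scope.
Local Open Scope ring_scope.

(** The ratio recursion of the Catalan numbers, from which the limit of consecutive ratios can be
    read off. *)
Fixpoint catalan (R : realType) (m : nat) : R :=
  if m is k.+1 then catalan R k * (4 * k%:R + 2) / (k%:R + 2) else 1.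

Lemma catalan_gt0 (R : realType) m : 0 < catalan R m.
Proof.
elim: m => [|m IH] /=; first exact: ltr01.
have m0 : 0 <= m%:R :> R by [].
by rewrite !mulr_gt0 ?invr_gt0 //; lra.
Qed.

(* Gosper's telescoping of the convolution, in terms of the central binomial
   coefficients (k + 1) * catalan k. *)
Lemma catalan_convolution (R : realType) m :
  \sum_(0 <= k < m.+1) catalan R k * catalan R (m - k) = catalan R m.+1.
Proof.
pose b k : R := (k%:R + 1) * catalan R k.
(* [g] changes sign under the exchange of [k] and [m.+1 - k], so the sum telescopes to twice
   [g m.+1]. *)
pose g k : R := b k * b (m.+1 - k)%N * (2 * k%:R - m%:R - 1)
                / (2 * (m%:R + 1) * (m%:R + 2)).
have m0 : 0 <= m%:R :> R by [].
rewrite (eq_big_nat _ _ (F2 := fun k => g k.+1 - g k)) => [|k /andP[_ km]].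
  rewrite telescope_sumr // /g subnn subn0 /b /= -natr1.
  by field; apply/andP; split; apply: lt0r_neq0; lra.
have [e mE] : exists e, m = (k + e)%N by exists (m - k)%N; lia.
rewrite /g subSS subSn // mE addKn /b /= -!natr1 natrD.
have k0 : 0 <= k%:R :> R by [].
have e0 : 0 <= e%:R :> R by [].
by field; repeat (apply/andP; split); apply: lt0r_neq0; lra.
Qed.

Lemma dab_countE (R : realType) m : (dab_count m)%:R = catalan R m.
Proof.
elim/ltn_ind: m => -[|m] IH; first by rewrite dab_count0.
rewrite dab_count_rec natr_sum -catalan_convolution.
apply: eq_big_nat => k /andP[_ km]; rewrite natrM !IH //.
by rewrite ltnS leq_subr.
Qed.

Lemma cvg_dab_count_ratio (R : realType) :
  (dab_count m)%:R / (dab_count m.+1)%:R @[m --> \oo] --> (1 / 4 : R).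
Proof.
have rE m : (dab_count m)%:R / (dab_count m.+1)%:R =
    (m%:R + 2) / (4 * m%:R + 2) :> R.
  rewrite !dab_countE /=; have := catalan_gt0 R m => /lt0r_neq0 c0.
  have m0 : 0 <= m%:R :> R by [].
  by field; repeat (apply/andP; split) => //; apply: lt0r_neq0; lra.
under eq_fun do rewrite rE.
(* The ratio exceeds 1/4 by (3/2) / (4m + 2), which is at most 1 / (m + 1). *)
apply: (@squeeze_cvgr _ _ _ _ (fun=> 1 / 4) (fun m => 1 / 4 + harmonic m)).
- apply: nearW => m; have m0 : 0 <= m%:R :> R by [].
  have m2 : 0 < 4 * m%:R + 2 :> R by lra.
  apply/andP; split; first by rewrite ler_pdivlMr //; lra.
  rewrite /harmonic /= -natr1 -lerBlDl -[leRHS]mul1r ler_pdivlMr; last lra.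
  rewrite [leLHS](_ : _ = (3 / 2 * (m%:R + 1)) / (4 * m%:R + 2)); last first.
    by field; apply: lt0r_neq0.
  by rewrite ler_pdivrMr //; lra.
- exact: cvg_cst.
- rewrite -[X in _ --> X]addr0.
  by apply: cvgD; [exact: cvg_cst|exact: cvg_harmonic].
Qed.

(** * The probabilities *)

Lemma P_words (R : realType) m i j : (i < 2 * m)%N ->
  P R m i.+1 j.+1 =
  (\sum_(w <- words (2 * m)) (nth 0 w i == j))%N%:R / (dab_count m)%:R.
Proof. by move=> im; rewrite /P card_sends // card_dab. Qed.

Lemma P_eq0 (R : realType) m i j : (i < 2 * m)%N ->
  (forall h, good (2 * m) h -> h i <> j) -> P R m i.+1 j.+1 = 0.
Proof.
move=> im hj; rewrite P_words // big_seq big1 ?mul0r // => w /wordsP[_ gw].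
by case: eqP => // wi; case: (hj _ gw).
Qed.

Theorem theorem5p1 (R : realType) :
  [/\ P R m 1 1 @[m --> \oo] --> (1 / 4 : R),
      P R m 1 (2 * m - 1) @[m --> \oo] --> (1 / 4 : R) &
      P R m 2 (2 * m - 1) @[m --> \oo] --> (1 / 4 : R)] /\
  [/\ forall m : nat, (1 <= m)%N -> P R m 1 2 = 0,
      forall m : nat, (1 <= m)%N -> P R m 1 (2 * m) = 0 &
      forall m : nat, (2 <= m)%N -> P R m 2 2 = 0].
Proof.
have cvg_ratio := @cvg_dab_count_ratio R.
split; split.
- rewrite -cvg_shiftS; under eq_fun do rewrite P_words // sum_head0.
  exact: cvg_ratio.
- rewrite -cvg_shiftS.
  under eq_fun => m.
    rewrite (_ : (2 * m.+1 - 1)%N = (2 * m).+1); last by lia.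
    rewrite P_words // sum_head_max; over.
  exact: cvg_ratio.
(* Two shifts, because [sum_second] starts at size 4. *)
- rewrite -cvg_shiftS -cvg_shiftS /=.
  under eq_fun => m.
    rewrite (_ : (2 * m.+2 - 1)%N = (2 * m.+1).+1); last by lia.
    rewrite P_words // sum_second; over.
  by move: cvg_ratio; rewrite -cvg_shiftS.
(* The value 0 must stand to the left of the value 1, which therefore cannot come first. *)
- move=> m m_gt0; apply: P_eq0 => [|h gh h0]; first by lia.
  have [|x xm hx] := good_surj (v := 0) gh; first by lia.
  by have := good_alt_inv gh (i := x) (j := 0); rewrite h0 hx; lia.
(* The first step ascends, so the maximum cannot come first. *)
- move=> m m_gt0; rewrite -(@prednK (2 * m)); last by lia.
  apply: P_eq0 => [|h gh h0]; first by lia.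
  have n1 : (1 < 2 * m)%N by lia.
  have := good_alt gh n1; rewrite h0 prednK; last by lia.
  by rewrite leqNgt (good_lt gh n1).
(* The value 2, present as [2 <= m], must stand to the left of the value 1 at position 1, hence at
   position 0; but the first step ascends. *)
- move=> m m_gt1; apply: P_eq0 => [|h gh h1]; first by lia.
  have [|x xm hx] := good_surj (v := 2) gh; first by lia.
  have [n1 n0] : (1 < 2 * m)%N /\ (0 < 2 * m)%N by lia.
  have := good_alt gh n1; have := good_alt_inv gh n1 xm.
  rewrite h1 hx => /(_ erefl).
  by case: x xm hx => [|[|x]] xm hx //; [rewrite hx | rewrite h1 in hx].
Qed.
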